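(* There exists a sequence $\{\mathbf n_j\}_{j\ge1}$ of count vectors such that, for UCB run with any confidence levels in $(0,1)$ (possibly depending on $\mathbf n_j$) and for greedy, $$\limsup_{j\to\infty}\sup_{\theta\in\Theta_{\mathbf n_j}}\frac{\mathcal R(\mathrm{UCB},\theta)}{\sqrt{\log|\mathbf n_j|}\cdot\mathcal E^*(\theta)}=+\infty,\qquad \limsup_{j\to\infty}\sup_{\theta\in\Theta_{\mathbf n_j}}\frac{\mathcal R(\mathrm{greedy},\theta)}{\sqrt{\log|\mathbf n_j|}\cdot\mathcal E^*(\theta)}=+\infty.$$
   Context: Batch bandit setting: there are $k$ arms. For counts $\mathbf n=(n_i)_{i\in[k]}$ (positive integers), $|\mathbf n|=\sum_in_i$, an instance $\theta\in\Theta_{\mathbf n}$ is given by means $\mu_i\in[0,1]$; for each arm $i$ there are $n_i$ i.i.d. observations $X_{i,1},\dots,X_{i,n_i}\sim\mathcal N(\mu_i,1)$, all observations $X=(X_{i,j})$ being independent. Let $\mu^*=\max_i\mu_i$ and let $a^*$ be an optimal arm. The simple regret of an algorithm $\mathcal A$ returning an arm $\mathcal A(X)\in[k]$ is $\mathcal R(\mathcal A,\theta)=\mu^*-\mathbb E_{X\sim\theta}[\mu_{\mathcal A(X)}]$. With $\hat\mu_i=\frac1{n_i}\sum_jX_{i,j}$ and $\beta_\delta=\sqrt{2\log(k/\delta)}$, UCB with confidence level $\delta\in(0,1)$ selects an arm in $\arg\max_i\hat\mu_i+\beta_\delta/\sqrt{n_i}$, and greedy selects an arm in $\arg\max_i\hat\mu_i$.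 Optimal value estimation: let $\mathcal V$ be the set of all estimators $\nu$ of $\mu^*$ that observe the data $X$ and are also given the optimal arm $a^*$. Fix a universal constant $c_{\mathcal V}\ge1$. The set of minimax optimal estimators is $\mathcal V^*_{\mathbf n}=\{\nu\in\mathcal V:\sup_{\theta\in\Theta_{\mathbf n}}\mathbb E_\theta[|\mu^*-\nu|]\le c_{\mathcal V}\inf_{\nu'\in\mathcal V}\sup_{\theta\in\Theta_{\mathbf n}}\mathbb E_\theta[|\mu^*-\nu'|]\}$, and $\mathcal E^*(\theta)=\inf_{\nu\in\mathcal V^*_{\mathbf n}}\mathbb E_\theta[|\mu^*-\nu|]$. Ratios use the conventions $x/0=+\infty$ for $x>0$ and $0/0=0$. *)

(* Defs.v *)
From HB Require Import structures.
From mathcomp Require Import all_boot all_order all_algebra.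
From mathcomp Require Import all_classical all_reals all_analysis.

Set Implicit Arguments.
Unset Strict Implicit.
Unset Printing Implicit Defensive.

Import Order.TTheory GRing.Theory Num.Theory.
Import numFieldNormedType.Exports.

Local Open Scope classical_set_scope.
Local Open Scope ring_scope.

Section tuple_prob.
Context {R : realType}.
Local Notation T := (measurableTypeR R).

Definition tcons (m : nat) (z : T * m.-tuple T) : m.+1.-tuple T :=
  [tuple of z.1 :: z.2].

Lemma measurable_tcons (m : nat) : measurable_fun setT (@tcons m).
Proof. exact: measurable_cons measurable_fst measurable_snd. Qed.

HB.instance Definition _ (m : nat) :=
  isMeasurableFun.Build _ _ _ _ (@tcons m) (@measurable_tcons m).

(* Product probability P_0 (x) ... (x) P_(m-1) on R^m (product sigma-algebra),
   i.e., the law of m independent reals, the l-th one having law P_l. *)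
Fixpoint tuple_prob (m : nat) :
    ('I_m -> probability T R) -> probability (m.-tuple T) R :=
  match m with
  | 0 => fun=> \d_([tuple] : 0.-tuple T)
  | m'.+1 => fun P =>
      distribution (P ord0 \x tuple_prob (fun l => P (lift ord0 l)))%E
                   (@tcons m')
  end.

(* Characterization of [tuple_prob] on measurable boxes. *)
Lemma tuple_prob_box (m : nat) (P : 'I_m -> probability T R)
    (B : 'I_m -> set T) : (forall l, measurable (B l)) ->
  tuple_prob P [set x | forall l, B l (tnth x l)] = (\prod_(l < m) P l (B l))%E.
Proof.
elim: m P B => [|m IH] P B mB.
  rewrite big_ord0 /= diracE (_ : _ \in _ = true)//.
  by apply/mem_set => -[].
rewrite big_ord_recl -(IH _ (fun l => B (lift ord0 l)))// /= /distribution
  /pushforward.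
set C := [set x | forall l, B (lift ord0 l) (tnth x l)].
have mC : measurable C.
  have -> : C = \bigcap_(l in [set: 'I_m])
      ((@tnth _ T ^~ l) @^-1` B (lift ord0 l)).
    by apply/seteqP; split => [x xB l _|x xB l]; [exact: xB|exact: (xB l I)].
  apply: fin_bigcap_measurable => // l _.
  by rewrite -[X in measurable X]setTI; exact: measurable_tnth.
rewrite -product_measure1E//; congr (product_measure1 _ _ _).
apply/seteqP; split => -[y x] /=.
  move=> H; split=> [|l]; first exact: (H ord0).
  by have := H (lift ord0 l); rewrite tnthS.
by move=> [By Cx] l; case: (unliftP ord0 l) => [l'|] -> //; rewrite tnthS.
Qed.

End tuple_prob.

Section batch_bandit.
Context {R : realType} {k : nat}.
Implicit Types (n : 'I_k -> nat) (mu : 'I_k -> R).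

Definition total_count n : nat := (\sum_i n i)%N.

(* Index set of the observations: pairs (i, j) with i an arm and j < n i. *)
Definition obs n : finType := {i : 'I_k & 'I_(n i)}.

Definition data n := (#|obs n|.-tuple (measurableTypeR R)).

Definition X n (x : data n) (i : 'I_k) (j : 'I_(n i)) : R :=
  tnth x (enum_rank (Tagged (fun i => 'I_(n i)) j : obs n)).

(* Law of the data: the X_(i,j) are independent, X_(i,j) ~ N(mu_i, 1). *)
Definition law n mu : probability (data n) R :=
  tuple_prob (fun l => normal_prob (mu (tag (enum_val l : obs n))) 1).

Definition Theta : set ('I_k -> R) := [set mu | forall i, 0 <= mu i <= 1].

(* The base value 0 of the maximum is harmless as means are nonnegative. *)
Definition mu_star mu : R := \big[Order.max/0]_i mu i.

(* A rule designating, for each instance, the optimal arm a^* that is revealed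
   to the estimators (it matters only when the maximal mean is not unique). *)
Definition optimal_arm (astar : ('I_k -> R) -> 'I_k) :=
  forall mu, Theta mu -> forall i, mu i <= mu (astar mu).

Definition algorithm n (A : data n -> 'I_k) :=
  forall a, measurable [set x | A x = a].

Definition regret n (A : data n -> 'I_k) mu : \bar R :=
  ((mu_star mu)%:E - 'E_(law n mu)[fun x => mu (A x)])%E.

Definition emp_mean n (x : data n) (i : 'I_k) : R :=
  (\sum_(j < n i) X x j) / (n i)%:R.

Definition beta_conf (delta : R) : R := Num.sqrt (2 * ln (k%:R / delta)).

Definition ucb_index n (delta : R) (x : data n) (i : 'I_k) : R :=
  emp_mean x i + beta_conf delta / Num.sqrt (n i)%:R.

(* Ties in the argmax may be broken in any measurable way. *)
Definition is_ucb n (delta : R) (A : data n -> 'I_k) :=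
  algorithm A /\ forall x i, ucb_index delta x i <= ucb_index delta x (A x).

Definition is_greedy n (A : data n -> 'I_k) :=
  algorithm A /\ forall x i, emp_mean x i <= emp_mean x (A x).

Definition estimator n : set (data n -> 'I_k -> R) :=
  [set nu | forall a, measurable_fun setT (nu ^~ a)].

Variable astar : ('I_k -> R) -> 'I_k.

Definition risk n (nu : data n -> 'I_k -> R) mu : \bar R :=
  'E_(law n mu)[fun x => `|mu_star mu - nu x (astar mu)|%R]%E.

Definition max_risk n (nu : data n -> 'I_k -> R) : \bar R :=
  ereal_sup [set risk nu mu | mu in Theta].

Definition minimax_estimator n (cV : R) : set (data n -> 'I_k -> R) :=
  [set nu | estimator nu /\
    (max_risk nu <= cV%:E * ereal_inf [set max_risk nu' | nu' in @estimator n])%E].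

Definition Estar n (cV : R) mu : \bar R :=
  ereal_inf [set risk nu mu | nu in @minimax_estimator n cV].

(* In [\bar R], 0^-1 = +oo and 0 * +oo = 0, so that x / 0 = +oo for x > 0 and
   0 / 0 = 0. *)
Definition worst_ratio n (cV : R) (A : data n -> 'I_k) : \bar R :=
  ereal_sup [set regret A mu /
    ((Num.sqrt (ln (total_count n)%:R))%:E * Estar n cV mu) | mu in Theta]%E.

End batch_bandit.

(* Main.v *)
(* One arm, [i0], is observed [N] times and every other arm once. On the
   instance where [i0] has mean 1 and all other arms have mean 0, both UCB (for
   any confidence level, as its bonus is larger on the rarely observed arms)
   and greedy miss [i0] with probability bounded below independently of [N].
   On the other hand the minimax risk of value estimation is bounded below by a
   constant, because the optimal arm may have been observed only once; hence an
   estimator that is minimax when the revealed arm is not [i0], and returns the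
   empirical mean when it is, remains minimax, while its risk on the instance
   above is O(1 / sqrt N).

   When [cV = 1] this requires exactly minimax estimators to exist. The sets of
   nearly minimax [0,1]-valued estimators are nested and convex, so
   near-minimizers of the L2 norm in them form a Cauchy sequence by the
   parallelogram identity; its limit is exactly minimax because all the
   laws of the data are mutually absolutely continuous. *)

Require Import Defs.
From mathcomp Require Import all_boot all_order all_algebra.
From mathcomp Require Import all_classical all_reals all_analysis.
From mathcomp Require Import measurable_realfun zify ring lra.
Set Implicit Arguments.
Unset Strict Implicit.
Unset Printing Implicit Defensive.
Import Order.TTheory GRing.Theory Num.Theory.
Import numFieldNormedType.Exports.
Import HBNNSimple.
Local Open Scope classical_set_scope.
Local Open Scope ring_scope.

(** * Existence of minimax functions *)

(* [q] stands for a squared norm, and 2 q(f) + 2 q(g) - 4 q(mid f g) for the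
   squared distance between [f] and [g]. *)
Lemma near_minimizing_sequence (R : realType) (V : Type) (C : R -> set V)
    (q : V -> R) (mid : V -> V -> V) (b : R) (e : nat -> R) :
  (forall s t, s <= t -> C s `<=` C t) ->
  (forall t, 0 < t -> C t !=set0) ->
  (forall t f g, C t f -> C t g -> C t (mid f g)) ->
  (forall t f, C t f -> 0 <= q f <= b) ->
  (forall n, 0 < e n) -> (forall n, e n.+1 <= e n) ->
  exists g : nat -> V, forall n, C (e n) (g n) /\
    2 * q (g n) + 2 * q (g n.+1) - 4 * q (mid (g n) (g n.+1)) <= 8 * e n.
Proof.
move=> Cmono C0 Cmid qb e0 edec.
pose D t := inf (q @` C t).
have hasinf t : 0 < t -> has_inf (q @` C t).
  move=> t0; split; first by have [f Cf] := C0 _ t0; exists (q f), f.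
  by exists 0 => _ [f Cf <-]; have /andP[] := qb _ _ Cf.
have Dle t f : 0 < t -> C t f -> D t <= q f.
  by move=> t0 Cf; apply: ge_inf; [exact: (hasinf _ t0).2|exists f].
have Ddec s t : 0 < s -> s <= t -> D t <= D s.
  move=> s0 st; apply: lb_le_inf; first exact: (hasinf _ s0).1.
  by move=> _ [f Cf <-]; apply: Dle; [exact: lt_le_trans st|exact: Cmono Cf].
pose S := D @` [set t | 0 < t].
have supS : has_sup S.
  split; first by exists (D 1), 1 => //=.
  exists b => _ [t /= t0 <-]; have [f Cf] := C0 _ t0.
  by apply: le_trans (Dle _ _ t0 Cf) _; have /andP[] := qb _ _ Cf.
pose D0 := sup S.
(* [D0] is the limit of the nonincreasing [D t] as [t] decreases to 0. Each chosen tolerance is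
   small enough for [D] to be within [e n] of [D0], and the chosen point nearly attains [D]
   there. *)
have H n : exists tg : R * V, [/\ 0 < tg.1, tg.1 <= e n, D0 - e n < D tg.1,
    C tg.1 tg.2 & q tg.2 < D0 + e n].
  have [_ [t /= t0 <-] Dt] := sup_adherent (e0 n) supS.
  have m0 : 0 < Num.min t (e n) by rewrite lt_min t0 e0.
  have [_ [f Cf <-] qf] := inf_adherent (e0 n) (hasinf _ m0).
  exists (Num.min t (e n), f); split => //=.
  - by rewrite ge_min lexx orbT.
  - by apply: lt_le_trans Dt _; apply: Ddec => //; rewrite ge_min lexx.
  - apply: lt_le_trans qf _; rewrite lerD2r; apply: ub_le_sup; first exact: supS.2.
    by exists (Num.min t (e n)).
have [tg Htg] := choice H.
exists (fun n => (tg n).2) => n; have [t0 te Dt Ct qt] := Htg n.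
split; first exact: Cmono Ct.
have [t0' te' Dt' Ct' qt'] := Htg n.+1.
(* The midpoint belongs to the larger of the two sets, so its term exceeds [4 * (D0 - e n)], while
   the other two terms together stay below [4 * (D0 + e n)]; the gap is [8 * e n]. *)
set s := Num.max (tg n).1 (tg n.+1).1.
have Cm : C s (mid (tg n).2 (tg n.+1).2).
  by apply: Cmid; [apply: Cmono Ct|apply: Cmono Ct'];
     rewrite le_max lexx ?orbT.
have s0 : 0 < s by rewrite lt_max t0.
have Ds : D0 - e n < D s.
  rewrite /s; case: (leP (tg n).1 (tg n.+1).1) => _ //.
  by apply: le_lt_trans Dt'; rewrite lerB// edec.
have := Dle _ _ s0 Cm; have := edec n; lra.
Qed.

(** The increments have L1 norm of order [2^-n], so their series converges absolutely almost
    everywhere, and [g] is recovered from it by telescoping. *)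
Lemma fast_L2_ae_cvg d (T : measurableType d) (R : realType)
    (P : probability T R) (g : nat -> T -> R) :
  (forall n, measurable_fun setT (g n)) ->
  (forall n, (\int[P]_x ((g n x - g n.+1 x) ^+ 2)%:E <=
              (8 * 4^-1 ^+ n)%:E)%E) ->
  {ae P, forall x, cvgn (g ^~ x)}.
Proof.
move=> mg gP; pose h n x := g n x - g n.+1 x.
have mh n : measurable_fun setT (h n) by apply: measurable_funB.
have mah n : measurable_fun setT (fun x => `|h n x|%:E).
  by apply/measurable_EFinP; exact: measurableT_comp.
have hP n : (\int[P]_x `|h n x|%:E <= (5 * 2^-1 ^+ n)%:E)%E.
  have p0 : 0 < 2 ^+ n :> R by rewrite exprn_gt0.
  (* AM-GM with weight [p = 2 ^+ n] replaces Cauchy-Schwarz: [|y| <= p / 2 * y ^+ 2 + p^-1 / 2],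
     since the difference is [p / 2 * (|y| - p^-1) ^+ 2]. The two terms integrate to at most
     [4 * p^-1] and [p^-1 / 2]. *)
  apply: (@le_trans _ _
      (\int[P]_x ((2 ^+ n / 2)%:E * (h n x ^+ 2)%:E + (2^-1 ^+ n / 2)%:E))%E).
    apply: ge0_le_integral => //=.
    - apply: emeasurable_funD => //; apply: emeasurable_funM => //.
      by apply/measurable_EFinP; exact: measurable_funX.
    - move=> x _; rewrite -EFinM -EFinD lee_fin -(real_normK (num_real (h n x))).
      rewrite exprVn; move: (2 ^+ n) p0 (`|h n x|) => p p0 y.
      have -> : p / 2 * y ^+ 2 + p^-1 / 2 = y + p / 2 * (y - p^-1) ^+ 2.
        by field; rewrite gt_eqF.
      by rewrite lerDl mulr_ge0 ?sqr_ge0 ?divr_ge0// ltW.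
  rewrite ge0_integralD//=; last 2 first.
  - by move=> x _; rewrite -EFinM lee_fin mulr_ge0 ?sqr_ge0// divr_ge0// ltW.
  - apply: emeasurable_funM => //.
    by apply/measurable_EFinP; exact: measurable_funX.
  rewrite ge0_integralZl//=; last 2 first.
  - by apply/measurable_EFinP; exact: measurable_funX.
  - by move=> x _; rewrite lee_fin sqr_ge0.
  rewrite integral_cst//= probability_setT mule1.
  apply: le_trans.
    apply: leeD2r; apply: lee_wpmul2l (gP n).
    by rewrite lee_fin divr_ge0// ltW.
  rewrite -EFinM -EFinD lee_fin (_ : 4^-1 = 2^-1 ^+ 2)//; last by field.
  rewrite exprAC !exprVn; move: (2 ^+ n) p0 => p p0.
  have -> : p / 2 * (8 * (p ^+ 2)^-1) + p^-1 / 2 = 5 * p^-1 - p^-1 / 2.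
    by field; rewrite gt_eqF.
  by rewrite gerDl oppr_le0 divr_ge0// invr_ge0 ltW.
pose S x : \bar R := (\sum_(n <oo) `|h n x|%:E)%E.
have mS : measurable_fun setT S.
  apply: ge0_emeasurable_sum => //.
have intS : P.-integrable setT S.
  apply/integrableP; split => //.
  under eq_integral do rewrite gee0_abs ?nneseries_ge0//.
  rewrite integral_nneseries//.
  apply: (@le_lt_trans _ _ (\sum_(n <oo) (5 * 2^-1 ^+ n)%:E)%E).
    apply: lee_nneseries => [n _ _|n _]; last exact: hP.
    by apply: integral_ge0 => x _; rewrite lee_fin.
  apply: (@le_lt_trans _ _ 10%:E); last exact: ltry.
  apply: lime_le; first by apply: is_cvg_nneseries => n _ _; rewrite lee_fin mulr_ge0// exprn_ge0.
  apply: nearW => n; rewrite sumEFin lee_fin.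
  have -> : \sum_(0 <= i < n) (5 * 2^-1 ^+ i) = 10 * (1 - 2^-1 ^+ n) :> R.
    elim: n => [|n IH]; first by rewrite big_geq// expr0 subrr mulr0.
    by rewrite big_nat_recr//= IH exprS; field.
  by rewrite -[leRHS]mulr1 ler_wpM2l// gerDl oppr_le0 exprn_ge0.
have := integrable_ae measurableT intS.
apply: filterS => x /(_ Logic.I) Sx.
have cvgh : cvgn (series (fun n => h n x)).
  apply: normed_cvg; apply: nondecreasing_is_cvgn.
    by apply: nondecreasing_series => n _ _; exact: normr_ge0.
  exists (fine (S x)) => _ [n _ <-] /=.
  rewrite -lee_fin fineK// /series/= -sumEFin; apply: nneseries_lim_ge => //.
have -> : g ^~ x = fun n => g 0%N x - series (fun n => h n x) n.
  apply/funext => n; rewrite /series/=.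
  rewrite (eq_bigr (fun i => - (g i.+1 x - g i x))); last by move=> i _; rewrite /h opprB.
  by rewrite sumrN telescope_sumr// opprK addrC subrK.
by apply: is_cvgB => //; exact: is_cvg_cst.
Qed.

Lemma integral_prob_le d (T : measurableType d) (R : realType)
    (P : probability T R) (f : T -> R) (c : R) :
  measurable_fun setT f -> (forall x, 0 <= f x <= c) ->
  (\int[P]_x (f x)%:E <= c%:E)%E.
Proof.
move=> mf fc; rewrite -[leRHS]mule1 -(@probability_setT _ _ _ P) -integral_cst//.
apply: ge0_le_integral => //.
- by move=> x _; rewrite lee_fin; case/andP: (fc x).
- exact/measurable_EFinP.
- by move=> x _; rewrite lee_fin; case/andP: (fc x).
Qed.

(** [P0] supplies a single L2 norm for all the laws. Domination carries almost everywhere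
    convergence from [P0] to each [P i], where dominated convergence passes the risk bounds
    [V + 4^-n] to the limit. *)
Lemma exists_minimax_function d (T : measurableType d) (R : realType)
    (P0 : probability T R) (I : Type) (A : set I) (P : I -> probability T R)
    (m : I -> R) (V : R) :
  (forall i, A i -> P i `<< P0) -> (forall i, A i -> 0 <= m i <= 1) ->
  (forall e, 0 < e -> exists2 f : T -> R, measurable_fun setT f &
     forall i, A i -> (\int[P i]_x `|m i - f x|%:E <= (V + e)%:E)%E) ->
  exists2 f : T -> R, measurable_fun setT f &
    forall i, A i -> (\int[P i]_x `|m i - f x|%:E <= V%:E)%E.
Proof.
move=> PP0 m01 inf.
pose C t := [set f : T -> R | [/\ measurable_fun setT f, forall x, 0 <= f x <= 1 &
  forall i, A i -> (\int[P i]_x `|m i - f x|%:E <= (V + t)%:E)%E]].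
have mloss (f : T -> R) c : measurable_fun setT f ->
    measurable_fun setT (fun x => `|c - f x|%:E).
  move=> mf; apply/measurable_EFinP; apply: measurableT_comp => //.
  exact: measurable_funB.
pose q (f : T -> R) := fine (\int[P0]_x (f x ^+ 2)%:E).
pose mid (f g : T -> R) x := (f x + g x) / 2.
have mmid (f g : T -> R) : measurable_fun setT f -> measurable_fun setT g ->
    measurable_fun setT (mid f g).
  by move=> mf mg; apply: measurable_funM => //; exact: measurable_funD.
have sqr01 (f : T -> R) x : (forall x, 0 <= f x <= 1) -> 0 <= f x ^+ 2 <= 1.
  by move=> /(_ x) /andP[f0 f1]; rewrite sqr_ge0 expr_le1.
have qE (f : T -> R) : measurable_fun setT f -> (forall x, 0 <= f x <= 1) ->
    ((q f)%:E = \int[P0]_x (f x ^+ 2)%:E)%E.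
  move=> mf f01; rewrite /q fineK// ge0_fin_numE; last first.
    by apply: integral_ge0 => x _; rewrite lee_fin sqr_ge0.
  apply: (@le_lt_trans _ _ 1%:E); last exact: ltry.
  apply: integral_prob_le => [|x]; first exact: measurable_funX.
  exact: sqr01.
have [| | | | | |g Cg] :=
  @near_minimizing_sequence R _ C q mid 1 (fun n => 4^-1 ^+ n).
- move=> s t st f [mf f01 If]; split => // i Ai.
  by apply: le_trans (If i Ai) _; rewrite lee_fin lerD2l.
- move=> t t0; have [f mf If] := inf t t0.
  (* As the targets [m i] lie in [0, 1], clipping an estimate to [0, 1] cannot increase its
     error. *)
  exists (fun x => Num.max 0 (Num.min (f x) 1)); split.
  + by apply: measurable_maxr => //; exact: measurable_minr.
  + by move=> x; rewrite le_max lexx/= ge_max ler01/= ge_min lexx orbT.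
  + move=> i Ai; apply: le_trans (If i Ai); apply: ge0_le_integral => //.
    * by apply: mloss; apply: measurable_maxr => //; exact: measurable_minr.
    * exact: mloss.
    * move=> x _; rewrite lee_fin; have /andP[] := m01 i Ai.
      move: (m i) (f x) => a b a0 a1.
      case: (leP b 1) => b1; [case: (leP 0 b) => b0 //|rewrite max_r//].
      -- by rewrite (@ger0_norm _ (a - 0)) ?subr_ge0// ler_normr; apply/orP; left; lra.
      -- by rewrite (@ler0_norm _ (a - 1)) ?subr_le0// ler_normr; apply/orP; right; lra.
- move=> t f h [mf f01 If] [mh h01 Ih]; split => [|x|i Ai]; first exact: mmid.
    by have /andP[? ?] := f01 x; have /andP[? ?] := h01 x; rewrite /mid; apply/andP; split; lra.
  apply: (@le_trans _ _ (\int[P i]_x (2^-1%:E * `|m i - f x|%:E + 2^-1%:E * `|m i - h x|%:E))%E).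
    apply: ge0_le_integral => //.
    + exact/mloss/mmid.
    + by apply: emeasurable_funD; apply: emeasurable_funM => //; exact: mloss.
    + move=> x _; rewrite -!EFinM -EFinD lee_fin /mid.
      have -> : m i - (f x + h x) / 2 = 2^-1 * (m i - f x) + 2^-1 * (m i - h x) by field.
      by apply: le_trans (ler_normD _ _) _; rewrite !normrM gtr0_norm.
  rewrite ge0_integralD//=; try by
    [apply: emeasurable_funM => //; exact: mloss
    |move=> x _; rewrite -EFinM lee_fin mulr_ge0].
  rewrite !ge0_integralZl//=; try exact: mloss.
  have -> : ((V + t)%:E = 2^-1%:E * (V + t)%:E + 2^-1%:E * (V + t)%:E)%E.
    by rewrite -!EFinM -EFinD; congr EFin; field.
  by apply: leeD; apply: lee_wpmul2l; rewrite ?lee_fin//; [exact: If|exact: Ih].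
- move=> t f [mf f01 _]; rewrite -!lee_fin qE// integral_ge0/=; last first.
    by move=> x _; rewrite lee_fin sqr_ge0.
  apply: integral_prob_le => [|x]; first exact: measurable_funX.
  exact: sqr01.
- by move=> n; rewrite exprn_gt0.
- by move=> n; rewrite exprS ger_pMl ?exprn_gt0//; lra.
have mg n : measurable_fun setT (g n) by have [[]] := Cg n.
have g01 n x : 0 <= g n x <= 1 by have [[]] := Cg n.
have L2g n : (\int[P0]_x ((g n x - g n.+1 x) ^+ 2)%:E <= (8 * 4^-1 ^+ n)%:E)%E.
  have [_] := Cg n; rewrite -lee_fin; apply: le_trans.
  set u := g n; set v := g n.+1.
  have mu : measurable_fun setT u by exact: mg.
  have mv : measurable_fun setT v by exact: mg.
  have uv01 x : 0 <= mid u v x <= 1.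
    by have /andP[? ?] := g01 n x; have /andP[? ?] := g01 n.+1 x; rewrite /mid /u /v; apply/andP; split; lra.
  have sq0 (f : T -> R) : forall x, True -> (0 <= (f x ^+ 2)%:E)%E.
    by move=> x _; rewrite lee_fin sqr_ge0.
  have msq (f : T -> R) : measurable_fun setT f -> measurable_fun setT (fun x => (f x ^+ 2)%:E).
    by move=> mf; apply/measurable_EFinP; exact: measurable_funX.
  have muv : measurable_fun setT (fun x => u x - v x) by exact: measurable_funB.
  (* Parallelogram identity, in additive form so that no subtraction occurs in [\bar R]. *)
  have para : (\int[P0]_x ((u x - v x) ^+ 2)%:E + 4%:E * \int[P0]_x (mid u v x ^+ 2)%:E =
      2%:E * \int[P0]_x (u x ^+ 2)%:E + 2%:E * \int[P0]_x (v x ^+ 2)%:E)%E.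
    rewrite -!ge0_integralZl//; try by [exact: msq|apply: msq; exact: mmid|apply: sq0].
    rewrite -!ge0_integralD//; try by
      [exact: msq|apply: sq0
      |apply: emeasurable_funM => //; apply: msq => //; exact: mmid
      |move=> x _; rewrite -EFinM lee_fin mulr_ge0// sqr_ge0].
    apply: eq_integral => x _; rewrite -!EFinM -!EFinD; congr EFin.
    by rewrite /mid; field.
  move: para; rewrite -(qE u mu (g01 n)) -(qE v mv (g01 n.+1)).
  rewrite -(qE (mid u v) (mmid _ _ mu mv) uv01).
  have : (0 <= \int[P0]_x ((u x - v x) ^+ 2)%:E)%E by apply: integral_ge0; exact: sq0.
  case: (\int[P0]_x ((u x - v x) ^+ 2)%:E)%E => [r| |]//.
  by move=> _; rewrite -!EFinM -!EFinD => -[] re; rewrite lee_fin; lra.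
have ubg x : has_ubound (range (g ^~ x)).
  by exists 1 => _ [k _ <-]; case/andP: (g01 k x).
have lbg x : has_lbound (range (g ^~ x)).
  by exists 0 => _ [k _ <-]; case/andP: (g01 k x).
(* The limit superior is measurable on the whole space and agrees with the limit wherever the
   sequence converges. *)
pose f x := limn_sup (g ^~ x).
have mf : measurable_fun setT f by apply: measurable_fun_limn_sup.
exists f => // i Ai.
have cvgP0 : {ae P0, forall x, cvgn (g ^~ x)} by exact: fast_L2_ae_cvg.
have cvgPi : {ae P i, forall x, cvgn (g ^~ x)}.
  case: cvgP0 => B [mB B0 sB]; exists B; split => //.
  by move/null_content_dominatesP: (PP0 i Ai); apply.
have [| | | | |_ _ cv] := @dominated_convergence _ T R (P i) setT measurableT
  (fun n x => `|m i - g n x|%:E) (fun x => `|m i - f x|%:E) (cst 1%:E).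
- by move=> n; exact: mloss.
- exact: mloss.
- apply: filterS cvgPi => x cg _.
  apply: cvg_EFin; first exact: nearW.
  apply: cvg_norm; apply: cvgB; first exact: cvg_cst.
  by rewrite /f cvg_limn_supE.
- exact: finite_measure_integrable_cst.
- apply: aeW => x n _; rewrite /= lee_fin normr_id.
  have /andP[? ?] := g01 n x; have /andP[? ?] := m01 i Ai.
  by rewrite ler_norml; apply/andP; split; lra.
rewrite -(cvg_lim _ cv)//.
have cvV : (V + 4^-1 ^+ n)%:E @[n --> \oo] --> V%:E.
  apply: cvg_EFin; first exact: nearW.
  rewrite -[X in _ --> X]addr0; apply: cvgD; first exact: cvg_cst.
  by apply: cvg_expr; rewrite gtr0_norm//; lra.
rewrite -(cvg_lim _ cvV)//; apply: lee_lim.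
- by apply/cvg_ex; eexists; exact: cv.
- by apply/cvg_ex; eexists; exact: cvV.
- by apply: nearW => n /=; have [[_ _ +] _] := Cg n; apply.
Qed.

(** * Measures with a density *)

Section density.
Context d (T : measurableType d) (R : realType).
Variables (mu nu : {measure set T -> \bar R}) (p : T -> R).
Hypothesis mp : measurable_fun setT p.
Hypothesis p0 : forall x, 0 <= p x.
Hypothesis nuE : forall A, measurable A -> (nu A = \int[mu]_(x in A) (p x)%:E)%E.

Let mp' : measurable_fun setT (EFin \o p).
Proof. exact/measurable_EFinP. Qed.

Let integral_density_indic A : measurable A ->
  (\int[nu]_x (\1_A x)%:E = \int[mu]_x ((\1_A x)%:E * (p x)%:E))%E.
Proof.
move=> mA; rewrite integral_indic// setIT nuE// [LHS]integral_mkcond.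
apply: eq_integral => x _; rewrite patchE indicE.
by case: ifPn => _; rewrite ?mul1e ?mul0e.
Qed.

Let integral_density_nnsfun (f : {nnsfun T >-> R}) :
  (\int[nu]_x (f x)%:E = \int[mu]_x ((f x)%:E * (p x)%:E))%E.
Proof.
under [LHS]eq_integral do rewrite fimfunE -fsumEFin//.
rewrite [LHS]ge0_integral_fsum//; last 2 first.
  - by move=> r; exact/measurable_EFinP/measurableT_comp.
  - by move=> n x _; rewrite EFinM nnfun_muleindic_ge0.
under [RHS]eq_integral.
  move=> x xD; rewrite fimfunE -fsumEFin// ge0_mule_fsuml; last first.
    by move=> r; rewrite EFinM nnfun_muleindic_ge0.
  over.
rewrite [RHS]ge0_integral_fsum//; last 2 first.
  - move=> r; apply: emeasurable_funM => //; apply/measurable_EFinP.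
    exact/measurableT_comp.
  - by move=> n x _; rewrite mule_ge0 ?lee_fin// -lee_fin EFinM nnfun_muleindic_ge0.
apply: eq_fsbigr => r; rewrite inE => -[t _ <-].
under [RHS]eq_integral do rewrite EFinM -muleA.
rewrite [RHS]ge0_integralZl//; try by
  [apply: emeasurable_funM => //; exact/measurable_EFinP
  |move=> x _; rewrite mule_ge0 ?lee_fin
  |rewrite lee_fin].
rewrite -integral_density_indic//.
under [LHS]eq_integral do rewrite EFinM.
rewrite ge0_integralZl//; try by
  [exact/measurable_EFinP|move=> x _; rewrite lee_fin|rewrite lee_fin].
Qed.

Lemma integral_density (f : T -> \bar R) :
  measurable_fun setT f -> (forall x, 0 <= f x)%E ->
  (\int[nu]_x f x = \int[mu]_x (f x * (p x)%:E))%E.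
Proof.
move=> mf f0; pose f_ := nnsfun_approx measurableT mf.
transitivity (lim (\int[nu]_x (f_ n x)%:E @[n --> \oo])%E).
  rewrite -monotone_convergence//=.
  - apply: eq_integral => ? /[!inE] xD; apply/esym/cvg_lim => //=.
    exact: cvg_nnsfun_approx.
  - by move=> n; exact/measurable_EFinP/measurable_funTS.
  - by move=> n ? _; rewrite lee_fin.
  - by move=> ? _ ? ? mn; rewrite lee_fin; exact/lefP/nd_nnsfun_approx.
transitivity (lim (\int[mu]_x ((f_ n x)%:E * (p x)%:E) @[n --> \oo])%E).
  by under eq_fun do rewrite integral_density_nnsfun.
rewrite -monotone_convergence//=.
- apply: eq_integral => x _; apply/cvg_lim => //.
  apply: cvgeZr => //; exact: cvg_nnsfun_approx.
- move=> n; apply: emeasurable_funM => //.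
  exact/measurable_EFinP/measurable_funTS.
- by move=> n x _; rewrite mule_ge0 ?lee_fin.
- move=> x _ a b ab; rewrite lee_wpmul2r ?lee_fin//.
  exact/lefP/nd_nnsfun_approx.
Qed.

End density.

(** * Independent families *)

Section tuple_prob_theory.
Context {R : realType}.
Local Notation T := (measurableTypeR R).

Lemma integral_tuple_probS (m : nat) (P : 'I_m.+1 -> probability T R)
    (f : m.+1.-tuple T -> \bar R) :
  measurable_fun setT f -> (forall x, 0 <= f x)%E ->
  (\int[tuple_prob P]_x f x = \int[P ord0]_y
     \int[tuple_prob (fun l => P (lift ord0 l))]_x f (tcons (y, x)))%E.
Proof.
move=> mf f0 /=; rewrite ge0_integral_distribution//.
rewrite fubini_tonelli1//=.
by apply: measurableT_comp => //; exact: measurable_tcons.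
Qed.

Lemma measurable_integral_tcons (m : nat) (P : 'I_m -> probability T R)
    (f : m.+1.-tuple T -> \bar R) :
  measurable_fun setT f -> (forall x, 0 <= f x)%E ->
  measurable_fun setT
    (fun y : T => \int[tuple_prob P]_x f (tcons (y, x)))%E.
Proof.
move=> mf f0.
apply: (@measurable_fun_fubini_tonelli_F _ _ _ _ _ (tuple_prob P) (f \o @tcons _ m)); last by move=> x; exact: f0.
by apply: measurableT_comp => //; exact: measurable_tcons.
Qed.

Lemma measurable_tcons1 (m : nat) (y : T) :
  measurable_fun setT (fun x : m.-tuple T => tcons (y, x)).
Proof. by apply: measurableT_comp; [exact: measurable_tcons|exact: measurable_pair1]. Qed.

(** Minorizations of the factors multiply under products. Comparing integrals of functions rather
    than measures of sets lets the induction apply to the inner integral of the iterated form. *)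
Lemma integral_tuple_prob_ge (m : nat) (P Q : 'I_m -> probability T R)
    (c : 'I_m -> R) :
  (forall l, 0 <= c l) ->
  (forall l (g : T -> \bar R), measurable_fun setT g -> (forall x, 0 <= g x)%E ->
     ((c l)%:E * \int[Q l]_x g x <= \int[P l]_x g x)%E) ->
  forall f : m.-tuple T -> \bar R,
  measurable_fun setT f -> (forall x, 0 <= f x)%E ->
  ((\prod_l c l)%:E * \int[tuple_prob Q]_x f x <= \int[tuple_prob P]_x f x)%E.
Proof.
elim: m P Q c => [|m IH] P Q c c0 PQ f mf f0; first by rewrite big_ord0 mul1e.
rewrite big_ord_recl !integral_tuple_probS// EFinM -muleA.
have mf1 y : measurable_fun setT (fun x : m.-tuple T => f (tcons (y, x))).
  by apply: measurableT_comp => //; exact: measurable_tcons1.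
have c'0 : 0 <= \prod_l c (lift ord0 l) by apply: prodr_ge0.
apply: le_trans (PQ ord0 _ _ _); last 2 first.
- exact: measurable_integral_tcons.
- by move=> y; exact: integral_ge0.
apply: lee_wpmul2l; first by rewrite lee_fin.
rewrite -ge0_integralZl//; last 2 first.
- exact: measurable_integral_tcons.
- by move=> y _; exact: integral_ge0.
apply: ge0_le_integral => //.
- by move=> y _; apply: mule_ge0 => //; exact: integral_ge0.
- by apply: emeasurable_funM => //; exact: measurable_integral_tcons.
- exact: measurable_integral_tcons.
- by move=> y _; apply: IH => // l; exact: PQ.
Qed.

(** The induction runs on vanishing integrals of nonnegative functions: a null iterated integral has
    an inner integral that is null off a [Q ord0]-null set, which is also [P ord0]-null. *)
Lemma tuple_prob_dominates (m : nat) (P Q : 'I_m -> probability T R) :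
  (forall l, P l `<< Q l) -> tuple_prob P `<< tuple_prob Q.
Proof.
move=> PQ.
suff H : forall f : m.-tuple T -> \bar R,
    measurable_fun setT f -> (forall x, 0 <= f x)%E ->
    (\int[tuple_prob Q]_x f x = 0 -> \int[tuple_prob P]_x f x = 0)%E.
  apply/null_content_dominatesP => A mA A0.
  have := H (fun x => (\1_A x)%:E); rewrite !integral_indic// !setIT.
  by apply => //; exact/measurable_EFinP/measurable_indic.
elim: m P Q PQ => [//|m IH] P Q PQ f mf f0.
rewrite !integral_tuple_probS//.
set F := (X in (\int[_]_y X y = 0)%E -> _); set G := (X in _ -> (\int[_]_y X y = 0)%E).
have mF : measurable_fun setT F by exact: measurable_integral_tcons.
have mG : measurable_fun setT G by exact: measurable_integral_tcons.
have F0 y : (0 <= F y)%E by exact: integral_ge0.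
have G0 y : (0 <= G y)%E by exact: integral_ge0.
move=> iF.
have /(ae_eq_integral_abs (Q ord0) measurableT mF).1 [B [mB B0 sB]] :
    (\int[Q ord0]_(x in setT) `|F x| = 0)%E.
  by under eq_integral do rewrite gee0_abs//.
have : (\int[P ord0]_(x in setT) `|G x| = 0)%E.
  apply/(ae_eq_integral_abs (P ord0) measurableT mG).2; exists B; split => //.
    by move/null_content_dominatesP: (PQ ord0); apply.
  apply: subset_trans sB; apply: subsetC => y /= Fy _.
  apply: IH (Fy Logic.I) => //.
  by apply: measurableT_comp => //; exact: measurable_tcons1.
by under eq_integral do rewrite gee0_abs//.
Qed.

End tuple_prob_theory.

(** * Normal laws *)

Section normal_facts.
Context {R : realType}.
Local Notation T := (measurableTypeR R).
Local Notation leb := (@lebesgue_measure R).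

Lemma integral_normal_prob (m s : R) (f : T -> \bar R) :
  measurable_fun setT f -> (forall x, 0 <= f x)%E ->
  (\int[normal_prob m s]_x f x = \int[leb]_x (f x * (normal_pdf m s x)%:E))%E.
Proof.
apply: integral_density => //; first exact: measurable_normal_pdf.
exact: normal_pdf_ge0.
Qed.

Lemma normal_pdf1E (m x : R) :
  normal_pdf m 1 x = normal_peak 1 * expR (- (x - m) ^+ 2 / 2).
Proof. by rewrite /normal_pdf oner_eq0 /normal_fun expr1n. Qed.

Lemma normal_peak1_gt0 : 0 < normal_peak (1 : R).
Proof. by rewrite normal_peak_gt0// oner_neq0. Qed.

Lemma lebesgue_dominates_normal (m : R) : leb `<< normal_prob m 1.
Proof.
apply/null_content_dominatesP => A mA; rewrite /normal_prob => iA.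
have mp : measurable_fun A (fun x => (normal_pdf m 1 x)%:E).
  by apply/measurable_funTS/measurable_EFinP; exact: measurable_normal_pdf.
have /(ae_eq_integral_abs leb mA mp).1 [B [mB B0 sB]] :
    (\int[leb]_(x in A) `|(normal_pdf m 1 x)%:E| = 0)%E.
  under eq_integral do rewrite gee0_abs ?lee_fin ?normal_pdf_ge0//.
  exact: iA.
apply: (subset_measure0 mA mB _ B0) => x Ax; apply: sB => /= /(_ Ax) [].
by apply/eqP; rewrite normal_pdf1E gt_eqF// mulr_gt0 ?normal_peak1_gt0 ?expR_gt0.
Qed.

Lemma normal_dominates_normal (m m' : R) : normal_prob m 1 `<< normal_prob m' 1.
Proof.
by move=> A /lebesgue_dominates_normal; exact: normal_prob_dominates.
Qed.

Lemma normal_prob_gt0 (m a b : R) : a < b ->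
  (0 < normal_prob m 1 `]a, b[%classic)%E.
Proof.
move=> ab; rewrite lt0e measure_ge0 andbT; apply/eqP => N0.
have /null_content_dominatesP/(_ _ _ N0) := @lebesgue_dominates_normal m.
move=> /(_ (measurable_itv _)); rewrite lebesgue_measure_itv/= lte_fin ab.
by move=> -[] /eqP; rewrite subr_eq0 gt_eqF.
Qed.

(** Chance that a single observation of a zero-mean arm lands above 2, that is, at least 1 above the
    best mean 1 of the hard instance. *)
Definition tail_mass : R := fine (normal_prob (0 : R) 1 `]2, 3[%classic).

Lemma tail_massE : normal_prob (0 : R) 1 `]2, 3[%classic = tail_mass%:E.
Proof. by rewrite fineK// fin_num_measure. Qed.

Lemma tail_mass_gt0 : 0 < tail_mass.
Proof. by rewrite -lte_fin -tail_massE normal_prob_gt0// ltr_nat. Qed.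

(* Exponential tilting turns the density of N(m, 1) into that of N(m + t, 1). *)
Lemma integral_normal_expR (m t : R) :
  (\int[normal_prob m 1]_x (expR (t * (x - m)))%:E = (expR (t ^+ 2 / 2))%:E)%E.
Proof.
rewrite integral_normal_prob; last 2 first.
- apply/measurable_EFinP; apply: measurableT_comp => //.
  by apply: measurable_funM => //; exact: measurable_funB.
- by move=> x; rewrite lee_fin expR_ge0.
transitivity (\int[leb]_x ((expR (t ^+ 2 / 2))%:E * (normal_pdf (m + t) 1 x)%:E))%E.
  apply: eq_integral => x _; rewrite -!EFinM !normal_pdf1E; congr EFin.
  rewrite mulrCA [RHS]mulrCA -!expRD.
  by congr (_ * expR _); field.
rewrite ge0_integralZl//; try by
  [apply/measurable_EFinP; exact: measurable_normal_pdf
  |move=> x _; rewrite lee_fin normal_pdf_ge0|rewrite lee_fin expR_ge0].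
by rewrite integral_normal_pdf mule1.
Qed.

(* Minimum over m and x in [0, 1] of the density of N(m, 1) at x. *)
Definition unif_minor : R := normal_peak 1 * expR (- 2^-1).

Lemma unif_minor_gt0 : 0 < unif_minor.
Proof. by rewrite mulr_gt0 ?normal_peak1_gt0 ?expR_gt0. Qed.

(** The bound is uniform in [m]: this is what makes different means of a rarely observed arm hard to
    tell apart. It comes from discarding the mass outside [0, 1]. *)
Lemma integral_normal_ge_uniform (m : R) (g : T -> \bar R) : 0 <= m <= 1 ->
  measurable_fun setT g -> (forall x, 0 <= g x)%E ->
  (unif_minor%:E * \int[uniform_prob (@ltr01 R)]_x g x <=
   \int[normal_prob m 1]_x g x)%E.
Proof.
move=> /andP[m0 m1] mg g0; rewrite integral_uniform// subr0 invr1 mul1e.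
have mgu : measurable_fun setT (fun x : R => g x * (normal_pdf m 1 x)%:E)%E.
  by apply: emeasurable_funM => //; apply/measurable_EFinP; exact: measurable_normal_pdf.
rewrite integral_normal_prob// -ge0_integralZl//; try by
  [exact: measurable_funTS|rewrite lee_fin ltW// unif_minor_gt0].
apply: (@le_trans _ _
    (\int[leb]_(x in `[0%R, 1%R]) (g x * (normal_pdf m 1 x)%:E))%E); last first.
  apply: ge0_subset_integral => //.
  by move=> x _; rewrite mule_ge0// lee_fin normal_pdf_ge0.
apply: ge0_le_integral => //.
- by move=> x _; rewrite mule_ge0// lee_fin ltW// unif_minor_gt0.
- by apply: emeasurable_funM => //; exact: measurable_funTS.
- exact: measurable_funTS.
move=> x; rewrite /= in_itv/= => /andP[x0 x1]; rewrite muleC lee_wpmul2l//.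
rewrite lee_fin normal_pdf1E ler_wpM2l ?(ltW normal_peak1_gt0)//.
by rewrite ler_expR mulNr lerN2 ler_pdivrMr// mulVf//; nra.
Qed.

Lemma integral_normal_tuple_expR (n : nat) (m w : 'I_n -> R) :
  (\int[tuple_prob (fun l => normal_prob (m l) 1)]_x
     (expR (\sum_l w l * (tnth x l - m l)))%:E =
   (expR ((\sum_l w l ^+ 2) / 2))%:E)%E.
Proof.
have mf k (v u : 'I_k -> R) : measurable_fun setT
    (fun x : k.-tuple T => (expR (\sum_l v l * (tnth x l - u l)))%:E).
  apply/measurable_EFinP; apply: measurableT_comp => //.
  apply: measurable_sum => l; apply: measurable_funM => //.
  by apply: measurable_funB => //; exact: measurable_tnth.
elim: n m w => [|n IH] m w.
  under eq_integral do rewrite big_ord0.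
  by rewrite big_ord0 mul0r integral_cst//= probability_setT mule1.
rewrite integral_tuple_probS//.
transitivity (\int[normal_prob (m ord0) 1]_y
   ((expR (w ord0 * (y - m ord0)))%:E *
    (expR ((\sum_l w (lift ord0 l) ^+ 2) / 2))%:E))%E.
  apply: eq_integral => y _; rewrite -(IH (m \o lift ord0) (w \o lift ord0)).
  rewrite -ge0_integralZl//; try by
    [exact: mf|move=> x _; rewrite lee_fin expR_ge0|rewrite lee_fin expR_ge0].
  apply: eq_integral => x _; rewrite big_ord_recl expRD EFinM tnth0.
  by under eq_bigr do rewrite tnthS.
rewrite ge0_integralZr//; try by
  [apply/measurable_EFinP; apply: measurableT_comp => //;
   apply: measurable_funM => //; exact: measurable_funB
  |move=> x _; rewrite lee_fin expR_ge0|rewrite lee_fin expR_ge0].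
by rewrite integral_normal_expR -EFinM -expRD big_ord_recl mulrDl.
Qed.

End normal_facts.

(** * Empirical means *)

(** The weighted sum has standard deviation [t^-1]. Rescaling the weights by [t] or [- t] gives unit
    variance, hence exponential moment [expR 2^-1], and the two moments control the absolute
    value. *)
Lemma normal_tuple_abs_le (R : realType) (n : nat) (m w : 'I_n -> R) (t : R) :
  0 < t -> \sum_l w l ^+ 2 = (t ^+ 2)^-1 ->
  (\int[tuple_prob (fun l => normal_prob (m l) 1)]_x
     `|\sum_l w l * (tnth x l - m l)|%:E <= (2 * expR 2^-1 / t)%:E)%E.
Proof.
move=> t0 wt; set P := tuple_prob _.
have mS (v : 'I_n -> R) : measurable_fun setT
    (fun x : n.-tuple (measurableTypeR R) => \sum_l v l * (tnth x l - m l)).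
  apply: measurable_sum => l; apply: measurable_funM => //.
  by apply: measurable_funB => //; exact: measurable_tnth.
have mE (v : 'I_n -> R) : measurable_fun setT
    (fun x : n.-tuple (measurableTypeR R) => (expR (\sum_l v l * (tnth x l - m l)))%:E).
  by apply/measurable_EFinP; apply: measurableT_comp => //; exact: mS.
have iE (v : 'I_n -> R) : \sum_l v l ^+ 2 = 1 ->
    (\int[P]_x (expR (\sum_l v l * (tnth x l - m l)))%:E = (expR 2^-1)%:E)%E.
  by move=> v1; rewrite integral_normal_tuple_expR v1 mul1r.
have sumZ (s : R) (x : n.-tuple (measurableTypeR R)) :
    \sum_l (s * w l) * (tnth x l - m l) = s * \sum_l w l * (tnth x l - m l).
  by rewrite mulr_sumr; apply: eq_bigr => l _; rewrite mulrA.
have sqZ (s : R) : s ^+ 2 = t ^+ 2 -> \sum_l (s * w l) ^+ 2 = 1.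
  move=> st; under eq_bigr do rewrite exprMn.
  by rewrite -mulr_sumr wt st mulfV// gt_eqF// exprn_gt0.
(* |y| <= (e^(ty) + e^(-ty)) / t *)
apply: (@le_trans _ _ (\int[P]_x (t^-1%:E *
    ((expR (\sum_l (t * w l) * (tnth x l - m l)))%:E +
     (expR (\sum_l (- t * w l) * (tnth x l - m l)))%:E)))%E).
  apply: ge0_le_integral => //.
  - by apply/measurable_EFinP; apply: measurableT_comp => //; exact: mS.
  - by apply: emeasurable_funM => //; exact: emeasurable_funD.
  - move=> x _; rewrite -EFinD -EFinM lee_fin !sumZ mulrC ler_pdivlMr//.
    move: (\sum_l _) => y; rewrite mulNr -[X in _ * X](gtr0_norm t0) -normrM.
    rewrite (mulrC y t); move: (t * y) => z.
    have := (expR_ge0 z, expR_ge0 (- z), expR_ge1Dx z, expR_ge1Dx (- z)).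
    by move=> [[[? ?] ?] ?]; rewrite ler_norml; apply/andP; split; lra.
rewrite ge0_integralZl//; try by
  [exact: emeasurable_funD|rewrite lee_fin invr_ge0 ltW
  |move=> x _; rewrite -EFinD lee_fin addr_ge0 ?expR_ge0].
rewrite ge0_integralD//; try by
  [exact: mE|move=> x _; rewrite lee_fin expR_ge0].
rewrite !iE; last 2 first.
- by apply: sqZ; rewrite sqrrN.
- exact: sqZ.
by rewrite -EFinD -EFinM lee_fin le_eqVlt; apply/orP; left; apply/eqP; ring.
Qed.

Section bandit_facts.
Context {R : realType} {k : nat}.
Variable n : 'I_k -> nat.
Implicit Types mu : 'I_k -> R.

Lemma big_obs (S : Type) (idx : S) (op : Monoid.com_law idx)
    (F : obs n -> S) :
  \big[op/idx]_(l < #|obs n|) F (enum_val l) =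
  \big[op/idx]_i \big[op/idx]_(j < n i) F (Tagged (fun i => 'I_(n i)) j).
Proof.
rewrite -big_enum_val.
rewrite (sig_big_dep _ _ (fun i (j : 'I_(n i)) => F (Tagged (fun i => 'I_(n i)) j))).
by apply: eq_bigr => -[].
Qed.

(** The data form a flat tuple indexed through the enumeration of [obs n]; this isolates the
    coordinates of one arm. A general [op] covers sums as well as products in [R] and in
    [\bar R]. *)
Lemma big_obs_arm (S : Type) (idx : S) (op : Monoid.com_law idx)
    (F : obs n -> S) (i0 : 'I_k) :
  \big[op/idx]_(l < #|obs n|)
     (if tag (enum_val l : obs n) == i0 then F (enum_val l) else idx) =
  \big[op/idx]_(j < n i0) F (Tagged (fun i => 'I_(n i)) j).
Proof.
rewrite (big_obs _ (fun o : obs n => if tag o == i0 then F o else idx)) /=.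
rewrite (bigD1 i0)//= eqxx [X in op _ X]big1 ?Monoid.mulm1// => i /negPf ii0.
by rewrite big1// => j _; rewrite ii0.
Qed.

Lemma mu_starE astar mu : optimal_arm astar -> Theta mu ->
  mu_star mu = mu (astar mu).
Proof.
move=> Hs Tm; apply/eqP; rewrite eq_le; apply/andP; split.
  by apply: bigmax_le => [|i _]; [case/andP: (Tm (astar mu))|exact: Hs].
by apply: le_bigmax_seq; rewrite // mem_index_enum.
Qed.

Lemma emp_mean_centered mu (x : data n) (i : 'I_k) : (0 < n i)%N ->
  emp_mean x i - mu i =
  \sum_l (if tag (enum_val l : obs n) == i then (n i)%:R^-1 else 0) *
     (tnth x l - mu (tag (enum_val l : obs n))).
Proof.
move=> ni.
transitivity (\sum_(l < #|obs n|) (if tag (enum_val l : obs n) == i then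
   (n i)%:R^-1 * (tnth x (enum_rank (enum_val l)) - mu (tag (enum_val l))) else 0)).
  rewrite (big_obs_arm _ (fun o : obs n =>
     (n i)%:R^-1 * (tnth x (enum_rank o) - mu (tag o)))) /=.
  rewrite -mulr_sumr sumrB sumr_const card_ord /emp_mean /X -mulr_natr.
  by field; rewrite pnatr_eq0 -lt0n.
by apply: eq_bigr => l _; rewrite enum_valK; case: ifP => _; rewrite ?mul0r.
Qed.

Lemma measurable_emp_mean (i : 'I_k) :
  measurable_fun setT (fun x : data n => emp_mean x i : R).
Proof.
apply: measurable_funM => //; apply: measurable_sum => j.
exact: measurable_tnth.
Qed.

Lemma emp_mean_abs_le mu (i : 'I_k) (t : R) : 0 < t -> (n i)%:R = t ^+ 2 ->
  (\int[law n mu]_x `|mu i - emp_mean x i|%:E <= (2 * expR 2^-1 / t)%:E)%E.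
Proof.
move=> t0 nt.
have ni : (0 < n i)%N by rewrite -(ltr_nat R) nt exprn_gt0.
pose w (l : 'I_#|obs n|) : R :=
  if tag (enum_val l : obs n) == i then (n i)%:R^-1 else 0.
under eq_integral => x _ do rewrite distrC (emp_mean_centered mu x ni) -/(w _).
apply: (normal_tuple_abs_le (fun l => mu (tag (enum_val l : obs n))) (w := w) t0).
transitivity (\sum_(l < #|obs n|)
    if tag (enum_val l : obs n) == i then (n i)%:R^-1 ^+ 2 : R else 0).
  by apply: eq_bigr => l _; rewrite /w; case: ifP; rewrite ?expr0n.
rewrite (big_obs_arm _ (fun o : obs n => (n i)%:R^-1 ^+ 2)) /=.
rewrite sumr_const card_ord -[LHS]mulr_natr nt.
by field; rewrite gt_eqF.
Qed.

Lemma law_dominates mu mu' : law n mu `<< law n mu'.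
Proof. by apply: tuple_prob_dominates => l; exact: normal_dominates_normal. Qed.

End bandit_facts.

(** * Minimax estimators and regret *)

Section minimax_facts.
Context {R : realType} {k : nat}.
Variable astar : ('I_k -> R) -> 'I_k.
Hypothesis Hastar : optimal_arm astar.
Variable n : 'I_k -> nat.
Implicit Types mu : 'I_k -> R.

Lemma riskE (nu : data n -> 'I_k -> R) mu : Theta mu ->
  risk astar nu mu = (\int[law n mu]_x `|mu (astar mu) - nu x (astar mu)|%:E)%E.
Proof. by move=> Tm; rewrite /risk unlock (mu_starE Hastar). Qed.

Definition spike (i : 'I_k) (s : R) : 'I_k -> R := fun j => if j == i then s else 0.

Lemma Theta_spike i s : 0 < s <= 1 -> Theta (spike i s).
Proof. by move=> /andP[s0 s1] j; rewrite /spike; case: ifP; rewrite ?(ltW s0)// lexx ler01. Qed.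

(** With [s > 0] the maximizer is unique, so every admissible rule [astar] reveals the same arm. *)
Lemma astar_spike i s : 0 < s <= 1 -> astar (spike i s) = i.
Proof.
move=> s01; have := Hastar (Theta_spike i s01) i.
rewrite /spike eqxx; case: eqP => // _; case/andP: s01 => s0 _.
by rewrite leNgt s0.
Qed.

(* The data cannot distinguish means 1 and 1/2 of an arm observed O(1) times:
   both laws dominate, up to a constant factor, the law in which this arm is
   uniform on [0, 1]. *)
Lemma max_risk_ge (i : 'I_k) (nu : data n -> 'I_k -> R) : estimator nu ->
  ((unif_minor ^+ n i / 4)%:E <= max_risk astar nu)%E.
Proof.
move=> mnu; set c := unif_minor ^+ n i.
have c0 : 0 < c by rewrite exprn_gt0// unif_minor_gt0.
pose Q (l : 'I_#|obs n|) : probability (measurableTypeR R) R :=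
  if tag (enum_val l : obs n) == i
  then (uniform_prob (@ltr01 R) : probability (measurableTypeR R) R)
  else (normal_prob 0 1 : probability (measurableTypeR R) R).
have mloss s : measurable_fun setT (fun x => `|s - nu x i|%:E).
  apply/measurable_EFinP; apply: measurableT_comp => //.
  by apply: measurable_funB => //; exact: mnu.
have Hs s : 0 < s <= 1 ->
    (c%:E * \int[tuple_prob Q]_x `|s - nu x i|%:E <= max_risk astar nu)%E.
  move=> s01; apply: (@le_trans _ _ (risk astar nu (spike i s))); last first.
    by apply: ereal_sup_ubound; exists (spike i s) => //; exact: Theta_spike.
  rewrite riskE; last exact: Theta_spike.
  rewrite astar_spike// {2}/spike eqxx.
  pose b (l : 'I_#|obs n|) : R :=
    if tag (enum_val l : obs n) == i then unif_minor else 1.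
  have <- : \prod_l b l = c.
    by rewrite /b (big_obs_arm _ (fun=> unif_minor)) prodr_const card_ord.
  apply: integral_tuple_prob_ge => // l.
    by rewrite /b; case: ifP; rewrite ?ler01// ltW// unif_minor_gt0.
  move=> g mg g0; rewrite /b /Q /spike; case: ifP => _; last by rewrite mul1e.
  by apply: integral_normal_ge_uniform => //; case/andP: s01 => /ltW-> ->.
have h1 : (c%:E * \int[tuple_prob Q]_x `|1 - nu x i|%:E <= max_risk astar nu)%E.
  by apply: Hs; rewrite ltr01 lexx.
have h2 : (c%:E * \int[tuple_prob Q]_x `|2^-1 - nu x i|%:E <= max_risk astar nu)%E.
  by apply: Hs; apply/andP; split; lra.
(* No estimate is close to both means: [|1 - v| + |2^-1 - v| >= 2^-1]. Hence twice the maximal risk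
   is at least [c / 2]. *)
have : ((c / 2)%:E <= max_risk astar nu + max_risk astar nu)%E.
  apply: le_trans (leeD h1 h2).
  rewrite -ge0_muleDr; try by apply: integral_ge0 => x _; rewrite lee_fin.
  rewrite EFinM; apply: lee_wpmul2l; first by rewrite lee_fin ltW.
  rewrite -ge0_integralD//.
  apply: (@le_trans _ _ (\int[tuple_prob Q]_x (2^-1)%:E)%E).
    by rewrite integral_cst//= probability_setT mule1.
  apply: ge0_le_integral => //; first exact: emeasurable_funD.
  move=> x _; rewrite -EFinD lee_fin.
  rewrite [leLHS](_ : _ = (1 - nu x i) - (2^-1 - nu x i)); last by field.
  by apply: le_trans (ler_norm _) _; exact: ler_normB.
case: (max_risk _ _) => [r| |].
- by rewrite -EFinD !lee_fin; lra.
- by move=> _; exact: leey.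
- by [].
Qed.

(** The zero estimator has risk at most 1, so the minimax value is a real number. *)
Lemma minimax_value (i : 'I_k) : exists2 V : R, unif_minor ^+ n i / 4 <= V &
  ereal_inf [set max_risk astar nu | nu in @estimator R k n] = V%:E.
Proof.
set I := ereal_inf _.
have Ige : ((unif_minor ^+ n i / 4)%:E <= I)%E.
  by apply: le_ereal_inf_tmp => _ [nu nuE <-]; exact: max_risk_ge.
have Ile : (I <= 1%:E)%E.
  apply: ge_ereal_inf; exists (max_risk astar (fun (x : data n) (a : 'I_k) => 0 : R)).
    by exists (fun (x : data n) (a : 'I_k) => 0).
  apply: ge_ereal_sup => _ [mu Tm <-]; rewrite riskE//.
  apply: integral_prob_le => // x; rewrite subr0.
  by have /andP[m0 m1] := Tm (astar mu); rewrite ger0_norm// m0.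
by move: Ige Ile; case: I => [r| |]//; rewrite lee_fin => ? _; exists r.
Qed.

(** Estimators see the revealed arm, so the problem splits into one problem per arm [a], each
    attained exactly. The law with all means 0 serves as the common reference. *)
Lemma exists_minimax_arm (V : R) (a : 'I_k) :
  ereal_inf [set max_risk astar nu | nu in @estimator R k n] = V%:E ->
  exists f : data n -> R, measurable_fun setT f /\
    forall mu, Theta mu -> astar mu = a ->
      (\int[law n mu]_x `|mu a - f x|%:E <= V%:E)%E.
Proof.
move=> VE.
have [|||f mf Hf] := @exists_minimax_function _ _ R (law n (fun=> 0)) _
  [set mu | Theta mu /\ astar mu = a] (@law R k n) (fun mu => mu a) V.
- by move=> mu _; exact: law_dominates.
- by move=> mu [Tm _]; exact: Tm.
- move=> e e0.
  have [|_ [nu nuE <-]] := @lb_ereal_inf_adherent R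
      [set max_risk astar nu | nu in @estimator R k n] e e0.
    by rewrite VE.
  rewrite VE -EFinD => nule; exists (nu ^~ a); first exact: nuE.
  move=> mu [Tm mua]; apply: le_trans (ltW nule).
  by apply: ereal_sup_ubound; exists mu => //; rewrite riskE// mua.
by exists f; split => // mu Tm mua; exact: Hf.
Qed.

(** The condition on [t] puts the risk of the empirical mean of [i0] below the lower bound that [i1]
    forces on the minimax value [V]. Splicing this mean into an exactly minimax estimator therefore
    keeps the maximal risk at most [V]. *)
Lemma Estar_le (cV : R) (i0 i1 : 'I_k) (t : R) mu : 1 <= cV ->
  0 < t -> (n i0)%:R = t ^+ 2 ->
  2 * expR 2^-1 / t <= unif_minor ^+ n i1 / 4 ->
  Theta mu -> astar mu = i0 ->
  (Estar astar n cV mu <= (2 * expR 2^-1 / t)%:E)%E.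
Proof.
move=> cV1 t0 nt tle Tm mu0.
have [V Vge VE] := minimax_value i1.
have [f Hf] := choice (fun a => exists_minimax_arm a VE).
pose nu (x : data n) a : R := if a == i0 then emp_mean x i0 else f a x.
have nuE : estimator nu.
  move=> a; rewrite /nu; case: (a == i0); last by have [] := Hf a.
  exact: (@measurable_emp_mean R k n i0).
apply: ge_ereal_inf; exists (risk astar nu mu); last first.
  by rewrite riskE// /nu mu0 eqxx; exact: emp_mean_abs_le.
exists nu => //; split => //; rewrite VE.
(* [V <= cV * V] uses [V >= 0], which follows from its lower bound. *)
apply: (@le_trans _ _ V%:E); last first.
  rewrite -EFinM lee_fin ler_peMl// (le_trans _ Vge)// divr_ge0//.
  by rewrite exprn_ge0// ltW// unif_minor_gt0.
apply: ge_ereal_sup => _ [mu' Tm' <-]; rewrite riskE// /nu.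
case: eqP => [->|_]; last by have [_] := Hf (astar mu'); apply.
apply: le_trans (emp_mean_abs_le _ t0 nt) _.
by rewrite lee_fin (le_trans tle).
Qed.

Lemma Estar_ge0 (cV : R) mu : (0 <= Estar astar n cV mu)%E.
Proof.
apply: le_ereal_inf_tmp => _ [nu _ <-]; rewrite /risk unlock.
by apply: integral_ge0 => x _; rewrite lee_fin.
Qed.

End minimax_facts.

Section regret.
Context {R : realType} {k : nat}.
Variable n : 'I_k -> nat.

(** If the only observation of [i1] exceeds 2 (event [B]) and [i0] is still returned, then the
    empirical mean of [i0] is at least 2 (event [D]), a deviation of at least 1 whose probability is
    at most [c]. So [i0] is returned with probability at most [c + 1 - tail_mass]. *)
Lemma regret_spike_ge (i0 i1 : 'I_k) (t : R) (A : data n -> 'I_k) :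
  i1 != i0 -> n i1 = 1%N -> 0 < t -> (n i0)%:R = t ^+ 2 ->
  algorithm A ->
  (forall x, A x = i0 -> (emp_mean x i1 : R) <= emp_mean x i0) ->
  ((tail_mass - 2 * expR 2^-1 / t)%:E <= regret A (spike i0 1))%E.
Proof.
move=> i10 n1 t0 nt mA HA; set mu := spike i0 1; set c := (2 * _ / t).
set P := law n mu.
pose W (l : 'I_#|obs n|) : set (measurableTypeR R) :=
  if tag (enum_val l : obs n) == i1 then `]2, 3[%classic : set R
  else [set: measurableTypeR R].
have mW l : measurable (W l) by rewrite /W; case: ifP.
pose B : set (data n) := [set x | forall l,
  W l (tnth x l)].
have PB : P B = tail_mass%:E.
  rewrite [LHS]tuple_prob_box//.
  transitivity (\prod_(l < #|obs n|) (if tag (enum_val l : obs n) == i1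
      then (tail_mass : R)%:E else 1 : \bar R))%E.
    apply: eq_bigr => l _; rewrite /W; case: eqP => [->|_]; last first.
      exact: (@probability_setT _ _ _ (normal_prob (mu _) 1)).
    by rewrite /mu /spike (negPf i10) -tail_massE.
  rewrite (big_obs_arm _ (fun=> (tail_mass : R)%:E)).
  by rewrite n1 big_ord1.
have mB : measurable B.
  have -> : B = \bigcap_(l in [set: 'I_#|obs n|]) ((@tnth _ (measurableTypeR R) ^~ l) @^-1` W l).
    by apply/seteqP; split => [x xB l _|x xB l]; [exact: xB|exact: (xB l Logic.I)].
  apply: fin_bigcap_measurable => // l _; rewrite -[X in measurable X]setTI.
  exact: measurable_tnth.
pose D : set (data n) := [set x | 2 <= (emp_mean x i0 : R)].
have mD : measurable D.
  rewrite -[X in measurable X]setTI; apply: measurable_fun_le => //.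
  exact: (@measurable_emp_mean R k n i0).
(* Markov's inequality: the indicator of [D] is at most the distance of the empirical mean from
   1. *)
have PD : (P D <= c%:E)%E.
  apply: le_trans (emp_mean_abs_le mu t0 nt).
  rewrite -[X in P X]setIT -integral_indic//; apply: ge0_le_integral => //.
  - exact/measurable_EFinP/measurable_indic.
  - apply/measurable_EFinP; apply: measurableT_comp => //.
    by apply: measurable_funB => //; exact: (@measurable_emp_mean R k n i0).
  move=> x _; rewrite lee_fin indicE /mu /spike eqxx.
  case: (boolP (x \in D)) => [|_]; last exact: normr_ge0.
  rewrite inE /D /= => Dx.
  by rewrite ler_normr; apply/orP; right; lra.
have BD : [set x | A x = i0] `&` B `<=` D.
  move=> x /= [Ax Bx]; apply: le_trans (HA x Ax).
  rewrite /emp_mean (_ : (n i1)%:R = 1); last by rewrite n1.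
  rewrite divr1.
  have <- : \sum_(j < n i1) 2 = 2 :> R by rewrite sumr_const card_ord n1.
  apply: ler_sum => j _; have := Bx (enum_rank (Tagged (fun i => 'I_(n i)) j)).
  by rewrite /W enum_rankK /= eqxx /= in_itv/= => /andP[/ltW].
set S := [set x | A x = i0]; have mS : measurable S by exact: mA.
have ES : ('E_P[fun x => mu (A x)] = P S)%E.
  rewrite -expectation_indic//; congr expectation; apply/funext => x.
  rewrite /mu /spike indicE; case: eqP => Ax; first by rewrite mem_set.
  by rewrite memNset.
have mu1 : mu_star mu = 1.
  apply/eqP; rewrite eq_le; apply/andP; split.
    by apply: bigmax_le => // i _; rewrite /mu /spike; case: ifP.
  rewrite [leLHS](_ : 1 = mu i0); last by rewrite /mu /spike eqxx.
  by apply: le_bigmax_seq; rewrite // mem_index_enum.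
rewrite /regret ES mu1 EFinB -PB.
have SB : (P S <= c%:E + (1 - P B))%E.
  rewrite -probability_setC//; apply: le_trans (leeD2r _ PD).
  apply: le_trans (measureU2 _ mD (measurableC mB)).
  apply: le_measure; rewrite ?inE//; first exact: measurableU (measurableC mB).
  by move=> x Sx; case: (pselect (B x)) => Bx; [left; exact: BD|right].
move: SB; rewrite -(fineK (fin_num_measure P _ mB)) -(fineK (fin_num_measure P _ mS)).
by rewrite -!EFinB -EFinD !lee_fin; lra.
Qed.

End regret.

(** Inversion reverses the order on all of [[0, +oo]], so the case [E = 0], where the quotient is
    [+oo], is included. *)
Lemma lee_div_ratio (R : realType) (r s e : R) (rho E : \bar R) :
  0 < r -> 0 < s -> 0 < e -> (r%:E <= rho)%E -> (0 <= E <= e%:E)%E ->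
  ((r / (s * e))%:E <= rho / (s%:E * E))%E.
Proof.
move=> r0 s0 e0 rrho /andP[E0 Ee].
have se0 : s * e != 0 by rewrite mulf_neq0// gt_eqF.
have -> : ((r / (s * e))%:E = r%:E * (s%:E * e%:E)^-1)%E.
  by rewrite -EFinM inver (negPf se0) -EFinM.
have sE0 : (0 <= s%:E * E)%E by rewrite mule_ge0// lee_fin ltW.
apply: lee_pmul => //.
- by rewrite lee_fin ltW.
- by rewrite inve_ge0 -EFinM lee_fin mulr_ge0// ltW.
rewrite lee_pV2 ?inE//.
  by apply: lee_wpmul2l => //; rewrite lee_fin ltW.
by rewrite -EFinM lee_fin mulr_ge0// ltW.
Qed.

(** * Growth of the worst ratio along skewed counts *)

Section conclusion.
Context {R : realType} {k : nat}.

Definition skewed_count (i0 : 'I_k) (N : nat) : 'I_k -> nat :=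
  fun i => if i == i0 then N else 1%N.

Lemma total_skewed_count (i0 : 'I_k) (N : nat) :
  total_count (skewed_count i0 N) = (N + k.-1)%N.
Proof.
rewrite /total_count (bigD1 i0)//= {1}/skewed_count eqxx; congr addn.
rewrite (eq_bigr (fun=> 1%N)) => [|i /negPf ii0]; last by rewrite /skewed_count ii0.
by rewrite sum1_card (cardC1 i0) card_ord.
Qed.

(** With [M ^ 4] observations of [i0], the optimal error on the hard instance is of order at most
    [M^-2], the logarithmic factor is at most [3 * M], and the regret is at least [tail_mass / 2]; a
    factor [M] survives. *)
Lemma worst_ratio_skewed_ge (astar : ('I_k -> R) -> 'I_k) (cV : R)
    (i0 i1 : 'I_k) (M : nat) (A : data (skewed_count i0 (M ^ 4)) -> 'I_k) :
  optimal_arm astar -> 1 <= cV -> i1 != i0 -> (0 < M)%N -> (k <= M)%N ->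
  2 * expR 2^-1 / M%:R <= tail_mass / 2 :> R ->
  2 * expR 2^-1 / M%:R <= unif_minor / 4 :> R ->
  algorithm A ->
  (forall x, A x = i0 -> (emp_mean x i1 : R) <= emp_mean x i0) ->
  ((tail_mass / (12 * expR 2^-1) * M%:R)%:E <= worst_ratio astar cV A)%E.
Proof.
move=> Hs cV1 i10 M0 kM Mtail Munif mA HA.
set n := skewed_count i0 (M ^ 4).
have n1 : n i1 = 1%N by rewrite /n /skewed_count (negPf i10).
have M1 : 1 <= M%:R :> R by rewrite ler1n.
pose t : R := M%:R ^+ 2.
have t0 : 0 < t by rewrite exprn_gt0// (lt_le_trans ltr01).
have n0 : (n i0)%:R = t ^+ 2 by rewrite /n /skewed_count eqxx natrX -exprM.
have e0 : 0 < expR 2^-1 :> R by exact: expR_gt0.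
have tM : 2 * expR 2^-1 / t <= 2 * expR 2^-1 / M%:R.
  rewrite ler_wpM2l ?mulr_ge0 ?(ltW e0)//.
  by rewrite lef_pV2 ?posrE// ?(lt_le_trans ltr01)// /t expr2 ler_peMr// (le_trans ler01).
have mu01 : 0 < (1 : R) <= 1 by rewrite ltr01 lexx.
pose s : R := Num.sqrt (ln (total_count n)%:R).
(* Two distinct arms give [k >= 2], so the logarithm is strictly positive. *)
have tot1 : (1 < total_count n)%N.
  rewrite total_skewed_count -(addn1 1%N) leq_add ?expn_gt0 ?M0//.
  by have := ltn_ord i0; have := ltn_ord i1; move: i10; rewrite -val_eqE /=; lia.
have s0 : 0 < s by rewrite sqrtr_gt0 ln_gt0// ltr1n.
(* The total count is at most [(2 * M) ^ 4] because [k <= M]; then [ln x < x] gives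
   [4 * ln (2 * M) <= 8 * M <= (3 * M) ^ 2]. *)
have s3 : s <= 3 * M%:R.
  rewrite -(@ger0_norm _ (3 * M%:R)); last by rewrite mulr_ge0.
  rewrite -sqrtr_sqr ler_wsqrtr//.
  apply: (@le_trans _ _ (ln ((2 * M%:R) ^+ 4))).
    rewrite ler_ln ?posrE ?exprn_gt0 ?mulr_gt0 ?ltr0n//; last exact: ltnW.
    rewrite -natrM -natrX ler_nat total_skewed_count.
    rewrite expnMn (_ : 2 ^ 4 = 16)%N//.
    have : (M <= M ^ 4)%N by rewrite -{1}(expn1 M) leq_pexp2l.
    lia.
  rewrite lnXn ?mulr_gt0 ?ltr0n//.
  have := @ln_sublinear R (2 * M%:R); rewrite mulr_gt0 ?ltr0n// => /(_ isT).
  rewrite -mulr_natr exprMn; nra.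
apply: (@le_trans _ _ (tail_mass / 2 / (s * (2 * expR 2^-1 / t)))%:E).
  rewrite lee_fin.
  rewrite (_ : _ / (s * _) = tail_mass / (4 * expR 2^-1) * (t / s)); last first.
    by field; rewrite !gt_eqF.
  rewrite (_ : tail_mass / (12 * _) * _ = tail_mass / (4 * expR 2^-1) * (M%:R / 3)); last first.
    by field; rewrite gt_eqF.
  apply: ler_wpM2l; first by rewrite divr_ge0 ?mulr_ge0 ?ltW// tail_mass_gt0.
  by rewrite ler_pdivlMr// /t; nra.
apply: le_ereal_sup_tmp; eexists.
  by exists (spike i0 1) => //; exact: Theta_spike.
apply: lee_div_ratio => //.
- by rewrite divr_gt0// tail_mass_gt0.
- by rewrite divr_gt0// mulr_gt0.
- apply: le_trans (regret_spike_ge i10 n1 t0 n0 mA HA).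
  by rewrite lee_fin; lra.
rewrite Estar_ge0/=; apply: (@Estar_le _ _ _ Hs _ _ i0 i1) => //.
- by rewrite n1 expr1 (le_trans tM).
- exact: Theta_spike.
- exact: astar_spike.
Qed.

(** [beta_conf] is a square root, hence nonnegative, so the bonus of [i1] is at least that of [i0].
    UCB thus obeys the same comparison as greedy, whatever the confidence level. *)
Lemma ucb_picks_less_sampled (n : 'I_k -> nat) (delta : R) (A : data n -> 'I_k)
    (i0 i1 : 'I_k) :
  (0 < n i1)%N -> (n i1 <= n i0)%N -> is_ucb delta A ->
  forall x, A x = i0 -> (emp_mean x i1 : R) <= emp_mean x i0.
Proof.
move=> n1 n10 [_ HA] x Ax; have := HA x i1; rewrite Ax /ucb_index => H.
suff : @beta_conf R k delta / Num.sqrt (n i0)%:R <=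
    @beta_conf R k delta / Num.sqrt (n i1)%:R.
  by move: H; lra.
apply: ler_wpM2l; first exact: sqrtr_ge0.
rewrite lef_pV2 ?posrE ?sqrtr_gt0 ?ltr0n ?(leq_trans n1)//.
by rewrite ler_wsqrtr// ler_nat.
Qed.

End conclusion.

Lemma limn_esup_linear (R : realType) (u : (\bar R)^nat) (c : R) (J : nat) :
  0 < c -> (forall j, ((c * (j + J)%:R)%:E <= u j)%E) -> limn_esup u = +oo%E.
Proof.
move=> c0 cu.
have uoo : u @ \oo --> +oo%E.
  apply/cvgeyPge => B; near=> j; apply: le_trans (cu j).
  rewrite lee_fin natrD mulrDr.
  apply: (@le_trans _ _ (c * j%:R)); last by rewrite lerDl mulr_ge0// ltW.
  rewrite mulrC -ler_pdivrMr//; near: j; exact: nbhs_infty_ger.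
by rewrite is_cvg_limn_esupE; [exact: cvg_lim|apply/cvg_ex; exists +oo%E].
Unshelve. all: by end_near. Qed.

Theorem proposition3 (R : realType) (k : nat) (hk : (1 < k)%N)
    (cV : R) (hcV : 1 <= cV)
    (astar : ('I_k -> R) -> 'I_k) (hastar : optimal_arm astar) :
  exists n : nat -> 'I_k -> nat,
    [/\ (forall j i, (0 < n j i)%N),
        (forall (delta : nat -> R) (A : forall j, data (n j) -> 'I_k),
           (forall j, 0 < delta j < 1) ->
           (forall j, is_ucb (delta j) (A j)) ->
           limn_esup (fun j => worst_ratio astar cV (A j)) = +oo%E)
      & (forall A : forall j, data (n j) -> 'I_k,
           (forall j, is_greedy (A j)) ->
           limn_esup (fun j => worst_ratio astar cV (A j)) = +oo%E)].
Proof.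
pose i0 := Ordinal (ltnW hk); pose i1 := Ordinal hk.
pose C : R := 2 * expR 2^-1.
have C0 : 0 < C by rewrite mulr_gt0 ?expR_gt0.
have tail0 : 0 < (tail_mass : R) / 2 by rewrite divr_gt0// tail_mass_gt0.
have unif0 : 0 < (unif_minor : R) / 4 by rewrite divr_gt0// unif_minor_gt0.
(* Shifting the index by [J] makes [M = j + J] satisfy, for every [j], the three largeness
   conditions of [worst_ratio_skewed_ge]. *)
pose J := (k + Num.bound (C / (tail_mass / 2)) + Num.bound (C / (unif_minor / 4)))%N.
pose n j := @skewed_count k i0 ((j + J) ^ 4).
have J0 j : (0 < j + J)%N by rewrite /J; lia.
have CJ j (b : R) : 0 < b -> (Num.bound (C / b) <= J)%N -> C / (j + J)%:R <= b.
  move=> b0 bJ; rewrite ler_pdivrMr ?ltr0n// mulrC -ler_pdivrMr//.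
  have Cb : 0 <= C / b by rewrite divr_ge0// ltW.
  apply/ltW; apply: lt_le_trans (archi_boundP Cb) _.
  by rewrite ler_nat (leq_trans bJ)// leq_addl.
have n_gt0 j i : (0 < n j i)%N.
  by rewrite /n /skewed_count; case: ifP => //; rewrite expn_gt0 J0.
have ratio j (A : data (n j) -> 'I_k) : algorithm A ->
    (forall x, A x = i0 -> (emp_mean x i1 : R) <= emp_mean x i0) ->
    ((tail_mass / (12 * expR 2^-1) * (j + J)%:R)%:E <= worst_ratio astar cV A)%E.
  move=> mA HA; apply: (@worst_ratio_skewed_ge _ _ _ _ i0 i1) => //.
  - by rewrite /J; lia.
  - by apply: CJ => //; rewrite /J; lia.
  - by apply: CJ => //; rewrite /J; lia.
have c0 : 0 < (tail_mass : R) / (12 * expR 2^-1).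
  by rewrite divr_gt0 ?tail_mass_gt0// mulr_gt0// expR_gt0.
exists n; split=> // [delta A _ HA|A HA]; apply: (limn_esup_linear c0) => j;
  apply: ratio; case: (HA j) => // _ HAj x Ax.
  (* [n j i1] computes to 1, so the remaining inequality [n j i1 <= n j i0] is the positivity of
     [n j i0]. *)
  by apply: (ucb_picks_less_sampled (n_gt0 j i1) _ (HA j)) => //; exact: n_gt0.
by have := HAj x i1; rewrite Ax.
Qed.
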